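(* There exists a positive absolute constant $c$ (one may take $c = 1/5$) such that the following holds. Let $n, r$ be integers with $1 \leq r \leq n-1$. If $\mathcal{A} \subset [n]^{(r)}$ with $|\mathcal{A}| = \alpha \binom{n}{r}$, then $$|b(\mathcal{A})| \geq c \sqrt{\frac{n}{r(n-r)}}\, \alpha(1-\alpha) \binom{n}{r}.$$
   Context: $[n] = \{1,2,\ldots,n\}$, and $[n]^{(r)}$ denotes the set of all $r$-element subsets of $[n]$. Two sets $x, y \in [n]^{(r)}$ are adjacent if $|x \Delta y| = 2$, where $\Delta$ denotes symmetric difference. For $\mathcal{A} \subset [n]^{(r)}$, the vertex-boundary of $\mathcal{A}$ is $$b(\mathcal{A}) = \{x \in [n]^{(r)} \setminus \mathcal{A} : |x \Delta y| = 2 \text{ for some } y \in \mathcal{A}\}.$$ ''Absolute constant'' means that $c$ does not depend on $n$, $r$, $\alpha$ or $\mathcal{A}$. The symbol $\subset$ allows equality. *)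

(* Defs.v *)
(* MathComp; real numbers are an arbitrary realType of MathComp-Analysis. *)
From mathcomp Require Import all_boot all_order all_algebra.
From mathcomp Require Import reals.

Set Implicit Arguments.
Unset Strict Implicit.
Unset Printing Implicit Defensive.

(* The ground set [n] = {1, ..., n} is represented by 'I_n = {0, ..., n - 1}. *)
Definition layer (n r : nat) : {set {set 'I_n}} := [set x : {set 'I_n} | #|x| == r].

Definition symdiff (T : finType) (x y : {set T}) : {set T} :=
  (x :\: y) :|: (y :\: x).

Definition vertex_boundary (n r : nat) (A : {set {set 'I_n}}) :
    {set {set 'I_n}} :=
  [set x in layer n r :\: A | [exists y in A, #|symdiff x y| == 2]].

(* Main.v *)
Require Import Defs.
From mathcomp Require Import all_boot all_order all_algebra.
From mathcomp Require Import reals ring lra zify.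

Set Implicit Arguments.
Unset Strict Implicit.
Unset Printing Implicit Defensive.
Import Order.TTheory GRing.Theory Num.Theory.
Local Open Scope ring_scope.

(** The proof is an induction on the size n of the ground set.  Fix a point i of
    the ground set and write p = r / n, q = (n - r) / n.  The sets of A that
    avoid i form a family A0 (the deletion) in the r-slice of the remaining n - 1
    points, and the sets that contain i, with i removed, a family A1 (the link)
    in the (r - 1)-slice.  With a and b their densities, A has density
    q a + p b, and the same splitting applies to the boundary of A: if beta0 and
    beta1 are the densities of its two sections, its density is
    q beta0 + p beta1.

    There are two sources of boundary.  Each section of the boundary of A
    contains the boundary of the corresponding section of A, to which the
    induction hypothesis applies.  Moreover, if y is in A1 and y together with j
    is not in A0, then y with j is a neighbour of y with i, so the deletion of
    the boundary contains the upper shadow of A1 minus A0; symmetrically the link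
    contains the lower shadow of A0 minus A1.  By the local LYM inequality a
    shadow is at least as dense as the family, so beta0 >= b - a and
    beta1 >= a - b.

    Let g be the claimed constant (1/5) sqrt (n / (r (n - r))), and g0, g1 the
    constants for the two smaller slices, so that g0 exceeds g by a factor of at
    least 1 + p / (2 n q) and g1 by at least 1 + q / (2 n p).  Writing
    v (x) = x (1 - x) and d for the difference of a and b,
        v (q a + p b) = q v (a) + p v (b) + p q d^2,
    so replacing the whole family by its sections loses g p q d^2.  If
    2 n p q d^2 <= p v (a) + q v (b), the increase of the constants pays for this
    loss.  Otherwise d is so large compared with v (a) or v (b) that the shadow
    bound d in one section outweighs both g v there and the loss.  This is
    lemma [two_section_step]; it is combined with the set-theoretic facts in
    [isoperimetric_step].  The induction stops at r = 1 or r = n - 1, where any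
    two distinct sets of the slice are adjacent. *)
(** * The numerical induction step *)

Section Rate.
Variable R : rcfType.
Implicit Types r s a b : R.

(** The constant for the r-slice of r + s points.  Taking r and s rather than r
    and n as parameters makes complementation the symmetry [rateC]. *)
Definition rate r s : R := Num.sqrt ((r + s) / (r * s)) / 5%:R.

Lemma rateC r s : rate r s = rate s r.
Proof. by rewrite /rate addrC [r * s]mulrC. Qed.

Lemma rate_ge0 r s : 0 <= rate r s.
Proof. by rewrite divr_ge0 ?sqrtr_ge0 ?ler0n. Qed.

Lemma sqr_rate r s : 0 < r -> 0 < s ->
  rate r s ^+ 2 = (r + s) / (25%:R * (r * s)).
Proof.
move=> r0 s0; rewrite /rate expr_div_n sqr_sqrtr; last first.
  by rewrite divr_ge0 ?mulr_ge0 ?addr_ge0 // ltW.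
by field; rewrite !gt_eqF.
Qed.

Lemma rate_le r s : 1 <= r -> 1 <= s -> rate r s <= 2%:R / 5%:R.
Proof.
move=> r1 s1; rewrite -(ler_pXn2r (n := 2)) ?nnegrE ?rate_ge0 //; last by lra.
rewrite sqr_rate; [|lra|lra].
rewrite ler_pdivrMr; last by nra.
nra.
Qed.

(** Removing a point outside the sets raises the constant.  Squaring the exact
    ratio gives 1 + x with x = r / ((r + s) (s - 1)), and the claim is a weakening
    of sqrt (1 + x) >= 1 + x / (2 + x) that has no square root. *)
Lemma rate_gain r s : 0 < r -> 1 < s ->
  rate r s * (1 + r / (2%:R * (r + s) * s)) <= rate r (s - 1).
Proof.
move=> r0 s1; have s0 : 0 < s by lra.
have d0 : 0 < 2%:R * (r + s) * s by nra.
have e0 : 0 <= r / (2%:R * (r + s) * s) by rewrite divr_ge0 // ltW.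
rewrite -(ler_pXn2r (n := 2)) ?nnegrE ?rate_ge0 //; last first.
  by rewrite mulr_ge0 ?rate_ge0 //; lra.
rewrite exprMn !sqr_rate //; last by lra.
have h : (1 + r / (2%:R * (r + s) * s)) ^+ 2 =
   (2%:R * (r + s) * s + r) ^+ 2 / (2%:R * (r + s) * s) ^+ 2.
  by field; rewrite !gt_eqF //; lra.
rewrite h mulrACA -invfM ler_pdivrMr; last by rewrite mulr_gt0 ?exprn_gt0 //; nra.
rewrite [leRHS]mulrAC ler_pdivlMr; last by nra.
rewrite -subr_ge0.
have -> : (r + (s - 1)) * (25%:R * (r * s) * (2 * (r + s) * s) ^+ 2) -
  (r + s) * (2 * (r + s) * s + r) ^+ 2 * (25%:R * (r * (s - 1))) =
  25%:R * r ^+ 2 * (r + s) * ((3%:R * r + 4%:R * s) * s + r) by ring.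
by rewrite ?mulr_ge0 ?sqr_ge0 //; nra.
Qed.

(** Here a and b are the densities of the two sections of the family, s / (r + s)
    and r / (r + s) their weights, b0 and b1 the boundary densities.  Only
    the section with the smaller density a receives the shadow bound b - a; the
    case where the other section is the sparser one follows by exchanging
    (r, a) with (s, b). *)
Lemma two_section_step r s a b g0 g1 b0 b1 :
  1 <= r -> 1 <= s -> 0 <= a -> a <= b -> b <= 1 ->
  rate r s * (1 + r / (2%:R * (r + s) * s)) <= g0 ->
  rate r s * (1 + s / (2%:R * (r + s) * r)) <= g1 ->
  g0 * (a * (1 - a)) <= b0 -> b - a <= b0 -> g1 * (b * (1 - b)) <= b1 ->
  rate r s * ((s * a + r * b) / (r + s)) * (1 - (s * a + r * b) / (r + s))
     * (r + s) <= s * b0 + r * b1.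
Proof.
move=> r1 s1 a0 ab b1' hg0 hg1 hb0 hd hb1.
have v0 : 0 <= a * (1 - a) by nra.
have v1 : 0 <= b * (1 - b) by nra.
have g_ge0 := rate_ge0 r s; have g_le := rate_le r1 s1.
have n0 : 0 < r + s by lra.
have : rate r s ^+ 2 * (25%:R * (r * s)) = r + s.
  by rewrite sqr_rate; [field; rewrite !gt_eqF //|..]; lra.
set g := rate r s in hg0 hg1 g_ge0 g_le * => g2.
have -> : g * ((s * a + r * b) / (r + s)) * (1 - (s * a + r * b) / (r + s))
     * (r + s) = g * (s * (a * (1 - a)) + r * (b * (1 - b)) +
     r * s / (r + s) * (b - a) ^+ 2) by field; rewrite gt_eqF.
have hb1' : g * (r + s / (2%:R * (r + s))) * (b * (1 - b)) <= r * b1.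
  have : r * (g1 * (b * (1 - b))) <= r * b1 by rewrite ler_pM2l //; lra.
  apply: le_trans; rewrite [leRHS]mulrA ler_wpM2r //.
  have -> : g * (r + s / (2 * (r + s))) = r * (g * (1 + s / (2 * (r + s) * r))).
    by field; rewrite !gt_eqF //; lra.
  by rewrite ler_pM2l //; lra.
have hb0' : g * (s + r / (2%:R * (r + s))) * (a * (1 - a)) <= s * b0.
  have : s * (g0 * (a * (1 - a))) <= s * b0 by rewrite ler_pM2l //; lra.
  apply: le_trans; rewrite [leRHS]mulrA ler_wpM2r //.
  have -> : g * (s + r / (2 * (r + s))) = s * (g * (1 + r / (2 * (r + s) * s))).
    by field; rewrite !gt_eqF //; lra.
  by rewrite ler_pM2l //; lra.
(* [small]: the gain in the rates covers the variance term. *)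
have [small|large] := leP (2%:R * (r * s) * (b - a) ^+ 2)
   (r * (a * (1 - a)) + s * (b * (1 - b))).
  have : g * (r * s / (r + s) * (b - a) ^+ 2) <=
     g * ((r * (a * (1 - a)) + s * (b * (1 - b))) / (2%:R * (r + s))).
    rewrite ler_wpM2l // ler_pdivlMr; last by lra.
    have -> : r * s / (r + s) * (b - a) ^+ 2 * (2 * (r + s)) =
       2%:R * (r * s) * (b - a) ^+ 2 by field; rewrite gt_eqF.
    by [].
  lra.
(* In the other case the jump b - a dominates g v for at least one of
   v = a (1 - a), v = b (1 - b): as v <= 1/4, it suffices to bound
   g^2 v / 4 by the square of (b - a) / 5. *)
have jump (v : R) : 0 <= v -> v <= 1 / 4%:R ->
    (r + s) * v <= 4%:R * (r * s) * (b - a) ^+ 2 -> g * v <= (b - a) / 5%:R.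
  move=> v_ge0 v_le hv.
  have gv : 0 <= g * v by rewrite mulr_ge0.
  have d5 : 0 <= (b - a) / 5%:R by lra.
  rewrite -(ler_pXn2r (n := 2)) ?nnegrE //.
  have rs0 : 0 < 25%:R * (r * s) by nra.
  rewrite -(ler_pM2r rs0) exprMn mulrAC g2.
  have : (r + s) * v ^+ 2 <= (r + s) * v / 4%:R.
    rewrite -mulrA ler_wpM2l //; [lra|nra].
  rewrite expr_div_n; lra.
have v4 (x : R) : x * (1 - x) <= 1 / 4%:R.
  by have := sqr_ge0 (x - 1 / 2%:R); lra.
(* It pays for the section a and for the variance term.  [jump] applies to the
   section whose v has the larger coefficient in [large]; passing from b (1 - b)
   to a (1 - a) costs at most b - a. *)
have key : g * (a * (1 - a) + r / (r + s) * (b - a) ^+ 2) <= b - a.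
  have p1 : r / (r + s) <= 1 by rewrite ler_pdivrMr //; lra.
  have p0 : 0 <= r / (r + s) by rewrite divr_ge0 //; lra.
  have pd : r / (r + s) * (b - a) ^+ 2 <= (b - a) ^+ 2 by rewrite ler_piMl ?sqr_ge0.
  have d1 : g * (b - a) <= 2%:R / 5%:R * (b - a) by rewrite ler_wpM2r //; lra.
  have [rs|sr] := leP r s.
    have sr0 : 0 <= s - r by lra.
    have h1 : g * (b * (1 - b)) <= (b - a) / 5%:R.
      apply: jump => //; have := mulr_ge0 sr0 v1.
      have : 0 <= r * (a * (1 - a)) by rewrite mulr_ge0 //; lra.
      lra.
    have : g * (a * (1 - a) + r / (r + s) * (b - a) ^+ 2) <=
           g * (b * (1 - b) + (b - a)) by rewrite ler_wpM2l //; nra.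
    lra.
  have rs0 : 0 <= r - s by lra.
  have h0 : g * (a * (1 - a)) <= (b - a) / 5%:R.
    apply: jump => //; have := mulr_ge0 rs0 v0.
    have : 0 <= s * (b * (1 - b)) by rewrite mulr_ge0 //; lra.
    lra.
  have : g * (a * (1 - a) + r / (r + s) * (b - a) ^+ 2) <=
         g * (a * (1 - a) + (b - a)) by rewrite ler_wpM2l //; nra.
  lra.
have : s * (g * (a * (1 - a) + r / (r + s) * (b - a) ^+ 2)) <= s * b0.
  by rewrite ler_pM2l; lra.
have : 0 <= g * (s / (2%:R * (r + s))) * (b * (1 - b)).
  by rewrite mulr_ge0 // mulr_ge0 // divr_ge0 //; lra.
lra.
Qed.

End Rate.

(** * Slices, shadows and sections of a family *)

Section Slices.
Local Open Scope nat_scope.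

Lemma double_count (I J : finType) (A : {set I}) (B : {set J})
    (e : I -> J -> bool) (d d' : nat) :
  (forall i, i \in A -> d <= #|[set j in B | e i j]|) ->
  (forall j, j \in B -> #|[set i in A | e i j]| <= d') ->
  #|A| * d <= #|B| * d'.
Proof.
move=> dA dB; rewrite -!sum_nat_const.
apply: (@leq_trans (\sum_(i in A) \sum_(j in B) e i j)).
  apply: leq_sum => i iA; apply: leq_trans (dA i iA) _.
  by rewrite -sum1dep_card big_mkcondr.
rewrite exchange_big; apply: leq_sum => j jB; apply: leq_trans (dB j jB).
by rewrite -sum1dep_card big_mkcondr.
Qed.

Variable T : finType.
Implicit Types (S x y z : {set T}) (A : {set {set T}}) (i j : T) (k r : nat).

(** Slices are taken inside a fixed finite type, with the ground set S as a
    parameter, so that induction on S changes no type. *)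
Definition slice S k : {set {set T}} := [set x : {set T} | x \subset S & #|x| == k].

Definition slice_boundary S r A : {set {set T}} :=
  [set x in slice S r :\: A | [exists y in A, #|symdiff x y| == 2]].

Definition up_shadow S k A : {set {set T}} :=
  [set x in slice S k | [exists y in A, y \subset x]].

Definition down_shadow S k A : {set {set T}} :=
  [set x in slice S k | [exists y in A, x \subset y]].

Lemma subset_cardS x y : x \subset y -> #|y| = #|x|.+1 ->
  exists2 j, j \notin x & y = j |: x.
Proof.
move=> xy yx; have /cards1P [j yxj] : #|y :\: x| == 1 by rewrite cardsDS // yx subSnn.
have : j \in y :\: x by rewrite yxj set11.
rewrite inE => /andP[jx _]; exists j => //.
by rewrite -{1}(setID y x) (setIidPr xy) yxj setUC.
Qed.

Lemma card_supersets S k z : z \in slice S k ->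
  #|[set y in slice S k.+1 | z \subset y]| = #|S| - k.
Proof.
rewrite inE => /andP[zS /eqP zk].
have -> : [set y in slice S k.+1 | z \subset y] = (fun j => j |: z) @: (S :\: z).
  apply/setP => y; rewrite !inE; apply/idP/imsetP => [|[j]].
    case/andP => /andP[yS /eqP yk] zy.
    have [|j jz yE] := subset_cardS zy; first by rewrite yk zk.
    by exists j; rewrite // inE jz (subsetP yS) // yE setU11.
  rewrite inE => /andP[jz jS] ->.
  by rewrite subUset sub1set jS zS cardsU1 jz zk subsetUr add1n eqxx.
rewrite card_in_imset => [|i j]; first by rewrite cardsDS // zk.
rewrite !inE => /andP[iz _] /andP[jz _] /setP /(_ i).
by rewrite !inE eqxx /= (negbTE iz) orbF => /esym /eqP.
Qed.

(** Each y in the slice lies in #|S| - k sets of the next one, each of which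
    has k + 1 subsets of size k; double counting the inclusions between A
    and its shadow gives the ratio of the two binomials.  The conclusion is the
    cross-multiplied inequality of densities. *)
Lemma local_lym_up S k A : A \subset slice S k ->
  #|A| * 'C(#|S|, k.+1) <= #|up_shadow S k.+1 A| * 'C(#|S|, k).
Proof.
move=> /subsetP AS.
have dc : #|A| * (#|S| - k) <= #|up_shadow S k.+1 A| * k.+1.
  apply: (double_count (e := fun y x : {set T} => y \subset x)) => [y yA|x].
    rewrite -(card_supersets (AS y yA)); apply/subset_leq_card/subsetP => x.
    rewrite !inE => /andP[-> yx]; rewrite yx !andbT.
    by apply/existsP; exists y; rewrite yA.
  rewrite !inE => /andP[/andP[_ /eqP xk] _].
  have -> : k.+1 = 'C(#|x|, k) by rewrite xk binSn.
  rewrite -cards_draws; apply/subset_leq_card/subsetP => y.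
  rewrite !inE => /andP[yA ->] /=.
  by have := AS y yA; rewrite inE => /andP[].
rewrite -(leq_pmul2r (ltn0Sn k)) -mulnA [_ * k.+1]mulnC mul_bin_left.
by rewrite mulnA [leqRHS]mulnAC leq_mul2r dc orbT.
Qed.

(** The same incidences counted from the larger sets downwards; the bound on k
    keeps the common factor #|S| - k cancellable. *)
Lemma local_lym_down S k A : k < #|S| -> A \subset slice S k.+1 ->
  #|A| * 'C(#|S|, k) <= #|down_shadow S k A| * 'C(#|S|, k.+1).
Proof.
move=> kS /subsetP AS.
have dc : #|A| * k.+1 <= #|down_shadow S k A| * (#|S| - k).
  apply: (double_count (e := fun y x : {set T} => x \subset y)) => [y yA|x].
    have := AS y yA; rewrite inE => /andP[yS /eqP yk].
    have {1}-> : k.+1 = 'C(#|y|, k) by rewrite yk binSn.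
    rewrite -cards_draws; apply/subset_leq_card/subsetP => x.
    rewrite !inE => /andP[xy ->]; rewrite xy (subset_trans xy yS) /= andbT.
    by apply/existsP; exists y; rewrite yA.
  rewrite inE => /andP[xS _]; rewrite -(card_supersets xS).
  apply/subset_leq_card/subsetP => y.
  by rewrite !inE => /andP[yA ->]; have := AS y yA; rewrite inE => ->.
have dk : 0 < #|S| - k by rewrite subn_gt0.
rewrite -(leq_pmul2r dk) -mulnA ['C(_, k) * _]mulnC -mul_bin_left.
by rewrite mulnA [leqRHS]mulnAC leq_mul2r dc orbT.
Qed.

Definition link i A : {set {set T}} := [set x : {set T} | i \notin x & i |: x \in A].
Definition deletion i A : {set {set T}} := [set x in A | i \notin x].

Lemma card_link_deletion i A : #|A| = #|deletion i A| + #|link i A|.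
Proof.
rewrite -(cardsID [set x : {set T} | i \notin x] A); congr (_ + _).
  by apply: eq_card => x; rewrite !inE.
have inj : {in link i A &, injective (fun x => i |: x)}.
  move=> x y; rewrite !inE => /andP[ix _] /andP[iy _] xy.
  by rewrite -(setU1K ix) xy setU1K.
rewrite -(card_in_imset inj); apply: eq_card => x; rewrite !inE negbK.
apply/andP/imsetP => [[ix xA]|[y]].
  by exists (x :\ i); rewrite ?inE ?eqxx /= setD1K.
by rewrite inE => /andP[iy yA] ->; rewrite setU11.
Qed.

Lemma symdiffU1 i x y : i \notin x -> i \notin y ->
  symdiff (i |: x) (i |: y) = symdiff x y.
Proof.
move=> ix iy; apply/setP => j; rewrite !inE.
by case: eqP => [->|] //=; rewrite (negbTE ix) (negbTE iy).
Qed.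

Lemma card_symdiff_swap i j z : i != j -> i \notin z -> j \notin z ->
  #|symdiff (i |: z) (j |: z)| = 2.
Proof.
move=> ij iz jz; have -> : symdiff (i |: z) (j |: z) = [set i; j].
  apply/setP => l; rewrite !inE.
  case: (eqVneq l i) => [->|li] /=; first by rewrite (negbTE ij) (negbTE iz).
  by case: (eqVneq l j) => [->|lj] /=; rewrite ?(negbTE jz) //= andNb.
by rewrite cards2 ij.
Qed.

Section Split.
Variables (S : {set T}) (i : T) (k : nat) (A : {set {set T}}).
Hypotheses (iS : i \notin S) (AS : A \subset slice (i |: S) k.+1).

Lemma deletion_sub : deletion i A \subset slice S k.+1.
Proof.
apply/subsetP => x; rewrite inE => /andP[/(subsetP AS)].
rewrite !inE => /andP[xS ->] ix; rewrite andbT.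
apply/subsetP => j jx; have := subsetP xS j jx; rewrite !inE.
by case: eqP => // ji; rewrite -ji jx in ix.
Qed.

Lemma link_sub : link i A \subset slice S k.
Proof.
apply/subsetP => x; rewrite inE => /andP[ix /(subsetP AS)].
rewrite !inE cardsU1 ix add1n eqSS => /andP[xS ->]; rewrite andbT.
apply/subsetP => j jx; have := subsetP xS j; rewrite !inE jx orbT.
by case: eqP => [ji|_ /(_ isT)] //; rewrite -ji jx in ix.
Qed.

Lemma notin_slice l x : x \in slice S l -> i \notin x.
Proof. by rewrite inE => /andP[xS _]; apply: contra iS => /(subsetP xS). Qed.

Lemma slice_widen x : x \in slice S k.+1 -> x \in slice (i |: S) k.+1.
Proof. by rewrite !inE => /andP[xS ->]; rewrite (subset_trans xS) // subsetUr. Qed.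

Lemma slice_add x : x \in slice S k -> i |: x \in slice (i |: S) k.+1.
Proof.
move=> xS; have ix := notin_slice xS; move: xS; rewrite !inE => /andP[xS xk].
by rewrite setUS // cardsU1 ix add1n eqSS.
Qed.

Lemma boundary_deletion :
  slice_boundary S k.+1 (deletion i A) \subset
  deletion i (slice_boundary (i |: S) k.+1 A).
Proof.
apply/subsetP => x; rewrite inE => /andP[/setDP[xS xA] /existsP[y /andP[yA xy]]].
have ix := notin_slice xS; move: xA yA; rewrite !inE ix andbT => xA /andP[yA iy].
have := slice_widen xS; rewrite inE => -> /=; rewrite xA /= andbT.
by apply/existsP; exists y; rewrite yA.
Qed.

Lemma boundary_link :
  slice_boundary S k (link i A) \subset link i (slice_boundary (i |: S) k.+1 A).
Proof.
apply/subsetP => x; rewrite inE => /andP[/setDP[xS xA] /existsP[y /andP[yA xy]]].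
have ix := notin_slice xS; move: xA yA; rewrite !inE ix /= => xA /andP[iy yA].
have := slice_add xS; rewrite inE => -> /=; rewrite xA /=.
by apply/existsP; exists (i |: y); rewrite yA symdiffU1.
Qed.

(** If y is in the link and x = j |: y is not in the deletion, then x is adjacent
    to i |: y, which is in A, by exchanging i and j. *)
Lemma up_shadow_boundary :
  up_shadow S k.+1 (link i A) :\: deletion i A \subset
  deletion i (slice_boundary (i |: S) k.+1 A).
Proof.
apply/subsetP => x /setDP[]; rewrite inE => /andP[xS /existsP[y /andP[yA yx]]] xA.
have ix := notin_slice xS; have yS := subsetP link_sub _ yA.
move: xA yA; rewrite !inE ix andbT => xA /andP[iy yA].
have := slice_widen xS; rewrite inE => -> /=; rewrite xA /= andbT.
apply/existsP; exists (i |: y); rewrite yA /=.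
move: xS yS; rewrite !inE => /andP[xS /eqP xk] /andP[yS /eqP yk].
have [|j jy xE] := subset_cardS yx; first by rewrite xk yk.
rewrite xE.
by rewrite card_symdiff_swap //; apply: contraNneq ix => <-; rewrite xE setU11.
Qed.

(** If y = j |: x is in the deletion and x is not in the link, then i |: x is
    adjacent to y, again by exchanging i and j. *)
Lemma down_shadow_boundary :
  down_shadow S k (deletion i A) :\: link i A \subset
  link i (slice_boundary (i |: S) k.+1 A).
Proof.
apply/subsetP => x /setDP[]; rewrite inE => /andP[xS /existsP[y /andP[yA xy]]] xA.
have ix := notin_slice xS; have yS := subsetP deletion_sub _ yA.
move: xA yA; rewrite !inE ix /= => xA /andP[yA iy].
have := slice_add xS; rewrite inE => -> /=; rewrite xA /=.
apply/existsP; exists y; rewrite yA /=.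
move: xS yS; rewrite !inE => /andP[xS /eqP xk] /andP[yS /eqP yk].
have [|j jx yE] := subset_cardS xy; first by rewrite xk yk.
rewrite yE.
by rewrite card_symdiff_swap //; apply: contraNneq iy => ->; rewrite yE setU11.
Qed.

End Split.

End Slices.

(** * Induction on the ground set *)

Section Isoperimetry.
Variables (R : rcfType) (T : finType).
Implicit Types (S : {set T}) (A : {set {set T}}) (k r : nat).

(** Since x and y have the same size, x :\: y and y :\: x do too; when r = 1 or
    the complements are singletons, this common size is at most 1. *)
Lemma slice_complete S r x y : r = 1%N \/ #|S| = r.+1 ->
  x \in slice S r -> y \in slice S r -> x != y -> #|symdiff x y| = 2%N.
Proof.
move=> hr; rewrite !inE => /andP[xS /eqP xr] /andP[yS /eqP yr] xy.
have xyD : #|x :\: y| = #|y :\: x|.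
  have := cardsID y x; have := cardsID x y; rewrite setIC xr yr; lia.
have xy0 : (0 < #|x :\: y|)%N.
  rewrite card_gt0 setD_eq0; apply: contraNN xy => xsuby.
  by rewrite eqEcard xsuby xr yr leqnn.
have xy1 : (#|x :\: y| <= 1)%N.
  case: hr => [r1|Sr].
    by apply: leq_trans (subset_leq_card (subsetDl _ _)) _; rewrite xr r1.
  apply: leq_trans (subset_leq_card (setSD y xS)) _.
  by rewrite cardsDS // yr Sr subSnn.
have disj : [disjoint x :\: y & y :\: x].
  by rewrite -setI_eq0; apply/eqP/setP => z; rewrite !inE; case: (z \in x); case: (z \in y).
rewrite /symdiff cardsU; move: disj; rewrite -setI_eq0 => /eqP ->.
rewrite cards0; lia.
Qed.

Lemma slice_boundary_complete S r A : r = 1%N \/ #|S| = r.+1 ->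
  A \subset slice S r -> A != set0 -> slice_boundary S r A = slice S r :\: A.
Proof.
move=> hr /subsetP AS /set0Pn [y yA]; apply/setP => x; rewrite inE.
apply: andb_idr => /setDP[xS xA]; apply/existsP; exists y.
have xy : x != y by apply: contraNneq xA => ->.
by rewrite yA (slice_complete hr xS (AS y yA) xy).
Qed.

Definition density S r A : R := #|A|%:R / 'C(#|S|, r)%:R.

Definition slice_isoperimetric S r : Prop := forall A, A \subset slice S r ->
  rate r%:R (#|S| - r)%:R * (density S r A * (1 - density S r A)) <=
  density S r (slice_boundary S r A).

Lemma density_bounds S r A : (r <= #|S|)%N -> A \subset slice S r ->
  0 <= density S r A <= 1.
Proof.
move=> rS /subset_leq_card; rewrite cards_draws => AN.
have N0 : (0 : R) < 'C(#|S|, r)%:R by rewrite ltr0n bin_gt0.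
by rewrite /density divr_ge0 ?ler0n //= ler_pdivrMr // mul1r ler_nat.
Qed.

(** In a complete slice the boundary of a nonempty family is its whole
    complement, of density 1 - a, and the rate is at most 2 / 5. *)
Lemma isoperimetric_base S r : (0 < r < #|S|)%N -> r = 1%N \/ #|S| = r.+1 ->
  slice_isoperimetric S r.
Proof.
move=> /andP[r0 rS] hr A AS; rewrite /density.
set N := 'C(_, r)%:R : R; set a := #|A|%:R / N.
have N0 : 0 < N by rewrite ltr0n bin_gt0 ltnW.
have [A0|An0] := eqVneq A set0.
  by rewrite /a A0 cards0 !mul0r mulr0 divr_ge0 ?ler0n.
have /andP[a0 a1] := density_bounds (ltnW rS) AS; rewrite /density -/N -/a in a0 a1.
have -> : #|slice_boundary S r A|%:R / N = 1 - a.
  rewrite slice_boundary_complete // cardsDS // cards_draws natrB.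
    by rewrite mulrBl divff // gt_eqF.
  by rewrite -cards_draws; apply: subset_leq_card.
have := @rate_le R r%:R (#|S| - r)%N%:R; rewrite !ler1n subn_gt0 => /(_ r0 rS).
have := rate_ge0 (r%:R : R) (#|S| - r)%N%:R.
move: (rate _ _) a a0 a1 => g a a0 a1 g0 g1.
have ga1 : g * a <= 1 by rewrite mulr_ile1 //; clear -g1; lra.
by rewrite mulrA ler_piMl // subr_ge0.
Qed.

(** With N0 and N1 the sizes of the two smaller slices, this turns the splitting
    of a cardinal into the splitting of a density; the hypothesis
    r N0 = s N1 says that N0 and N1 have proportions s and r. *)
Lemma weighted_mean (r s N0 N1 x y : R) :
  0 < r -> 0 < s -> 0 < N0 -> 0 < N1 -> r * N0 = s * N1 ->
  (x + y) / (N0 + N1) = (s * (x / N0) + r * (y / N1)) / (r + s).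
Proof.
move=> r0 s0 N00 N10 rN.
have -> : N1 = r * N0 / s by rewrite rN mulrAC divff ?mul1r // gt_eqF.
by field; rewrite !gt_eqF //; nra.
Qed.

Lemma isoperimetric_step S i k : i \notin S -> (0 < k)%N -> (k.+1 < #|S|)%N ->
  slice_isoperimetric S k.+1 -> slice_isoperimetric S k ->
  slice_isoperimetric (i |: S) k.+1.
Proof.
move=> iS k0 kS iso0 iso1 A AS; rewrite /density.
set N := 'C(_, _)%:R : R; set alpha := #|A|%:R / N.
have kltS := ltnW kS; have kleS := ltnW kltS.
have A0S := deletion_sub AS; have A1S := link_sub AS.
set B0 := deletion i (slice_boundary (i |: S) k.+1 A).
set B1 := link i (slice_boundary (i |: S) k.+1 A).
set N0 := 'C(#|S|, k.+1)%:R : R; set N1 := 'C(#|S|, k)%:R : R.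
set r := k.+1%:R : R; set s := (#|S| - k)%:R : R.
have cardS : #|i |: S| = #|S|.+1 by rewrite cardsU1 iS.
have N0_gt0 : 0 < N0 by rewrite ltr0n bin_gt0.
have N1_gt0 : 0 < N1 by rewrite ltr0n bin_gt0.
have r1 : 1 < r by rewrite ltr1n.
have s1 : 1 < s by rewrite ltr1n ltn_subRL addn1.
have NE : N = N0 + N1 by rewrite /N cardS binS natrD.
have rN0 : r * N0 = s * N1 by rewrite -!natrM mul_bin_left.
have r0 := lt_trans ltr01 r1; have s0 := lt_trans ltr01 s1.
set a := #|deletion i A|%:R / N0; set b := #|link i A|%:R / N1.
have /andP[a0 a1] : 0 <= a <= 1 by apply: density_bounds.
have /andP[b0 b1] : 0 <= b <= 1 by apply: density_bounds.
have alphaE : alpha = (s * a + r * b) / (r + s).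
  rewrite /alpha (card_link_deletion i A) natrD NE.
  exact: weighted_mean.
have BE : #|slice_boundary (i |: S) k.+1 A|%:R / N =
    (s * (#|B0|%:R / N0) + r * (#|B1|%:R / N1)) / (r + s).
  rewrite (card_link_deletion i (slice_boundary _ _ _)) natrD NE.
  exact: weighted_mean.
have sE : (#|i |: S| - k.+1)%:R = s by rewrite cardS subSS.
rewrite BE alphaE sE ler_pdivlMr ?addr_gt0 //.
have quot (X Y : {set {set T}}) (M : R) : 0 < M -> X \subset Y ->
    #|X|%:R / M <= #|Y|%:R / M.
  by move=> M0 /subset_leq_card XY; rewrite ler_pM2r ?invr_gt0 ?ler_nat.
have h0 : rate r (s - 1) * (a * (1 - a)) <= #|B0|%:R / N0.
  apply: le_trans (quot _ _ _ N0_gt0 (boundary_deletion k A iS)).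
  apply: le_trans (iso0 _ A0S).
  by have -> : (#|S| - k.+1)%:R = s - 1 by rewrite subnS -subn1 natrB // subn_gt0.
have h1 : rate s (r - 1) * (b * (1 - b)) <= #|B1|%:R / N1.
  apply: le_trans (quot _ _ _ N1_gt0 (boundary_link k A iS)).
  apply: le_trans (iso1 _ A1S).
  by rewrite rateC; have -> : r - 1 = k%:R by rewrite /r -natr1 addrK.
have cover (X Y Z : {set {set T}}) (M : R) : 0 < M -> X :\: Y \subset Z ->
    #|X|%:R / M - #|Y|%:R / M <= #|Z|%:R / M.
  move=> M0 /subset_leq_card XZ.
  rewrite lerBlDr -mulrDl ler_pM2r ?invr_gt0 // -natrD ler_nat -(cardsID Y X).
  by rewrite addnC leq_add // subset_leq_card // subsetIr.
have up : b - a <= #|B0|%:R / N0.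
  apply: le_trans (cover _ _ _ _ N0_gt0 (up_shadow_boundary iS AS)).
  rewrite lerD2r ler_pdivlMr // mulrAC ler_pdivrMr // -!natrM ler_nat.
  exact: local_lym_up.
have down : a - b <= #|B1|%:R / N1.
  apply: le_trans (cover _ _ _ _ N1_gt0 (down_shadow_boundary iS AS)).
  rewrite lerD2r ler_pdivlMr // mulrAC ler_pdivrMr // -!natrM ler_nat.
  exact: local_lym_down.
(* The link is the case of [rate_gain] with r and s exchanged. *)
have g0 : rate r s * (1 + r / (2%:R * (r + s) * s)) <= rate r (s - 1).
  exact: rate_gain.
have g1 : rate r s * (1 + s / (2%:R * (r + s) * r)) <= rate s (r - 1).
  by rewrite rateC [r + s]addrC; apply: rate_gain.
rewrite mulrA; have [ab|ba] := leP a b.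
  by apply: (two_section_step _ _ a0 ab b1 g0 g1 h0 up h1); exact: ltW.
rewrite [s * a + _]addrC [r + s]addrC rateC [leRHS]addrC.
rewrite rateC [r + s]addrC in g0; rewrite rateC [r + s]addrC in g1.
by apply: (two_section_step _ _ b0 (ltW ba) a1 g1 g0 h1 down h0); exact: ltW.
Qed.

Theorem slice_isoperimetry S r : (0 < r < #|S|)%N -> slice_isoperimetric S r.
Proof.
elim: {S}_.+1 {-2}S r (ltnSn #|S|) => // m IH S r Sm rS.
have [r1|rn1] := eqVneq r 1%N; first by apply: isoperimetric_base; [|left].
have [Sr|Snr] := eqVneq #|S| r.+1; first by apply: isoperimetric_base; [|right].
have [i iS] : exists i, i \in S by apply/set0Pn; rewrite -card_gt0; lia.
have cS := cardsD1 i S; rewrite iS in cS.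
case: r rS rn1 Snr => [|k] rS rn1 Snr; first by lia.
rewrite -(setD1K iS); apply: isoperimetric_step; rewrite ?inE ?eqxx //; try lia.
  by apply: IH; lia.
by apply: IH; lia.
Qed.

End Isoperimetry.

Theorem theorem2 (R : realType) :
  exists c : R,
    [/\ 0 < c,
        c = 1 / 5%:R &
        forall (n r : nat) (alpha : R) (A : {set {set 'I_n}}),
          (1 <= r <= n - 1)%N ->
          A \subset layer n r ->
          #|A|%:R = alpha * 'C(n, r)%:R ->
          c * Num.sqrt (n%:R / (r%:R * (n%:R - r%:R)))
            * alpha * (1 - alpha) * 'C(n, r)%:R
          <= #|vertex_boundary r A|%:R].
Proof.
exists (1 / 5%:R); split=> // [|n r alpha A rn AL Aa]; first by lra.
have layerE : layer n r = slice [set: 'I_n] r.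
  by apply/setP => x; rewrite !inE subsetT.
have N0 : (0 : R) < 'C(n, r)%:R by rewrite ltr0n bin_gt0; lia.
have := @slice_isoperimetry R _ [set: 'I_n] r; rewrite /slice_isoperimetric /density.
rewrite cardsT card_ord => /(_ _ A); rewrite -layerE => /(_ _ AL).
have -> : slice_boundary [set: 'I_n] r A = vertex_boundary r A.
  by rewrite /slice_boundary -layerE.
have -> : #|A|%:R / 'C(n, r)%:R = alpha by rewrite Aa mulfK // gt_eqF.
rewrite ler_pdivlMr // => H; apply: le_trans (H _); last by lia.
rewrite /rate natrB; last by lia.
by rewrite [r%:R + _]addrC subrK mul1r [5%:R^-1 * _]mulrC !mulrA.
Qed.
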